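(* Let $\Omega=(a,b)\subset\mathbb{R}$ be a bounded open interval, $f\in BV(\Omega)$, and $\alpha\in C(\overline{\Omega})$ with $\alpha'\in BV(\Omega)$ and $\alpha>0$ on $\overline\Omega$. Let $u$ be the solution of $$\min_{u\in BV(\Omega)}\ \frac12\int_\Omega (f-u)^2\,dx+\int_\Omega \alpha(x)\,d|Du| .$$ If $x\in\Omega$ satisfies $|D\alpha'|(\{x\})=0$, then $$|Du|(\{x\})\le |Df|(\{x\}).$$ Moreover, the jumps of $u$ and $f$ at $x$ have the same direction, i.e. if $Du(\{x\})\ne0$ and $Df(\{x\})\neq 0$, then $Du(\{x\})$ and $Df(\{x\})$ have the same sign.
   Context: For $u\in BV(\Omega)$, $Du$ denotes its distributional derivative (a finite signed Radon measure) and $|Du|$ its total variation measure; $u$ has a positive (negative) jump at $x$ if $Du(\{x\})>0$ ($Du(\{x\})<0$). The condition $\alpha'\in BV(\Omega)$ means that the weak derivative $\alpha'$ of $\alpha$ is a function of bounded variation; $D\alpha'$ is the distributional derivative of $\alpha'$. The minimisation problem has a unique solution. *)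

(* Defs.v *)
From HB Require Import structures.
From mathcomp Require Import all_boot all_order all_algebra.
From mathcomp Require Import all_classical all_reals all_analysis.

Set Implicit Arguments.
Unset Strict Implicit.
Unset Printing Implicit Defensive.

Import Order.TTheory GRing.Theory Num.Theory.
Import numFieldNormedType.Exports.

Local Open Scope classical_set_scope.
Local Open Scope ring_scope.

Section charge_total_variation.
Context d (T : measurableType d) (R : realType).
Implicit Types nu : {charge set T -> \bar R}.

Definition hahn_pos nu : set T := projT1 (cid (Hahn_decomposition nu)).

Definition hahn_neg nu : set T :=
  projT1 (cid (projT2 (cid (Hahn_decomposition nu)))).

Lemma hahn_posneg nu : hahn_decomposition nu (hahn_pos nu) (hahn_neg nu).
Proof. exact: (projT2 (cid (projT2 (cid (Hahn_decomposition nu))))). Qed.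

Definition tvar nu : {measure set T -> \bar R} :=
  charge_variation (hahn_posneg nu).

(* The measure [tvar nu] does not depend on the chosen Hahn decomposition. *)
Lemma tvarE nu P N (nuPN : hahn_decomposition nu P N) A :
  measurable A -> tvar nu A = charge_variation nuPN A.
Proof.
move=> mA; have [hp hn] := Hahn_decomposition_uniq (hahn_posneg nu) nuPN mA.
rewrite -[tvar nu A]/(jordan_pos _ A + jordan_neg _ A)%E.
rewrite -[charge_variation _ A]/(jordan_pos _ A + jordan_neg _ A)%E.
rewrite !jordan_posE !jordan_negE !cjordan_posE !cjordan_negE.
by rewrite /crestr0 mem_set// /crestr hp hn.
Qed.

Definition charge_integral nu (D : set T) (g : T -> R) : R :=
  \int[jordan_pos (hahn_posneg nu)]_(x in D) g x -
  \int[jordan_neg (hahn_posneg nu)]_(x in D) g x.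

End charge_total_variation.

Section bounded_variation_on_interval.
Context (R : realType).
Implicit Types (a b : R) (f u v alpha phi : R -> R).

Local Notation mu := (@lebesgue_measure R).

Definition supp phi : set R := closure [set x | phi x != 0].

(* phi is in C_c^oo(]a, b[). *)
Definition test_function a b phi : Prop :=
  [/\ forall n x, derivable (derive1n n phi) x 1,
      compact (supp phi) &
      supp phi `<=` `]a, b[].

Definition weak_derivative a b u (u' : R -> R) : Prop :=
  locally_integrable `]a, b[ u' /\
  forall phi, test_function a b phi ->
    \int[mu]_(x in `]a, b[) (u x * derive1 phi x) =
    - \int[mu]_(x in `]a, b[) (u' x * phi x).

(* Functions on ]a, b[ are represented by functions on R, and finite signed
   Radon measures on ]a, b[ by finite Borel charges on R; in both cases only
   what happens inside ]a, b[ is relevant. *)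
Definition distributional_derivative a b u
    (Du : {charge set (measurableTypeR R) -> \bar R}) : Prop :=
  forall phi, test_function a b phi ->
    \int[mu]_(x in `]a, b[) (u x * derive1 phi x) =
    - charge_integral Du `]a, b[ phi.

Definition BV a b u : Prop :=
  mu.-integrable `]a, b[ (EFin \o u) /\
  exists Du, distributional_derivative a b u Du.

Definition TV_energy a b f alpha u
    (Du : {charge set (measurableTypeR R) -> \bar R}) : \bar R :=
  (2^-1%:E * \int[mu]_(x in `]a, b[) ((f x - u x) ^+ 2)%:E +
   \int[tvar Du]_(x in `]a, b[) (alpha x)%:E)%E.

Definition TV_minimizer a b f alpha u : Prop :=
  BV a b u /\
  forall Du, distributional_derivative a b u Du ->
  forall v Dv, BV a b v -> distributional_derivative a b v Dv ->
    (TV_energy a b f alpha u Du <= TV_energy a b f alpha v Dv)%E.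

End bounded_variation_on_interval.

(* Main.v *)
Require Import Defs.
From HB Require Import structures.
From mathcomp Require Import all_boot all_order all_algebra.
From mathcomp Require Import all_classical all_reals all_analysis.
From mathcomp Require Import measurable_realfun lra ring.

Set Implicit Arguments.
Unset Strict Implicit.
Unset Printing Implicit Defensive.

Import Order.TTheory GRing.Theory Num.Theory.
Import numFieldNormedType.Exports.
Local Open Scope classical_set_scope.
Local Open Scope ring_scope.

(* Let [c] be the jump of [u] at [x] and [k] its sign.  Moving a portion [k * s]
   of that jump ([0 < s <= |c|]) to the right endpoint [x + h], resp. to the left
   endpoint [x - h], is an admissible competitor whose total variation term grows
   by at most [s * (alpha (x + h) - alpha x)], resp.
   [s * (alpha (x - h) - alpha x)].  Letting [s] tend to [0] in the two
   minimality inequalities and adding them gives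
     0 <= k * (int_x^(x+h) (f - u) - int_(x-h)^x (f - u))
          + (alpha (x + h) - alpha x) + (alpha (x - h) - alpha x).
   For [g] in BV, testing [Dg] with a tent function of height [h] centred at [x]
   shows that int_x^(x+h) g - int_(x-h)^x g = h * Dg {x} + o(h).  Dividing by [h]
   and letting it tend to [0] yields
   [0 <= k * (Df {x} - Du {x}) + Dalpha' {x}], where the last term vanishes. *)

(** * Flat functions [P(1/t) exp(-1/t)] and the smooth functions they generate *)

Definition flat_exp (R : realType) (P : {poly R}) (t : R) : R :=
  if 0 < t then P.[t^-1] * expR (- t^-1) else 0.

(** The exponential dominates each power, by a single term of its series. The exponent [k] is
    quantified inside the induction because in [P * 'X + c] the factor ['X] raises it by one. *)
Lemma poly_expR_bounded (R : realType) (P : {poly R}) :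
  forall k, exists C, forall y : R, 0 <= y -> `|P.[y]| * y ^+ k * expR (- y) <= C.
Proof.
elim/poly_ind: P => [k|P c IH k].
  by exists 0 => y y0; rewrite horner0 normr0 !mul0r.
have [C hC] := IH k.+1.
exists (C + `|c| * k`!%:R) => y y0.
rewrite hornerMXaddC.
have yk : y ^+ k * expR (- y) <= k`!%:R.
  rewrite expRN ler_pdivrMr ?expR_gt0//.
  case: k {IH hC} => [|k]; first by rewrite expr0 fact0 mul1r -expR0 ler_expR.
  have := expR_ge1Dxn k y0.
  move=> /(le_trans _) h.
  have {h} : y ^+ k.+1 / k.+1`!%:R <= expR y by apply: h; rewrite lerDr.
  by rewrite ler_pdivrMr ?ltr0n ?fact_gt0// mulrC.
have := hC y y0; rewrite exprS => hC'.
apply: le_trans (_ : (`|P.[y] * y| + `|c|) * (y ^+ k * expR (- y)) <= _).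
  by rewrite -mulrA ler_wpM2r ?mulr_ge0 ?exprn_ge0 ?expR_ge0// ler_normD.
rewrite mulrDl lerD// ?ler_wpM2l//.
by rewrite normrM (ger0_norm y0) !mulrA; move: hC'; rewrite !mulrA.
Qed.

(** Away from [0] this is the chain rule; at [0] the exponential decay beats every pole. The
    polynomial parameter is what makes the family closed under differentiation. *)
Lemma is_derive_flat_exp (R : realType) (P : {poly R}) (t : R) :
  is_derive t 1 (flat_exp P) (flat_exp ('X^2 * (P - P^`())) t).
Proof.
have [t0|t0|->] := ltgtP t 0.
- rewrite [X in is_derive _ _ _ X]/flat_exp ltNge (ltW t0)/=.
  apply: (@near_eq_is_derive _ _ _ (cst 0)).
  near=> s; rewrite /flat_exp; case: ifPn => // s0; exfalso.
  have : s < 0 by near: s; exact: lt_nbhsl.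
  by rewrite ltNge (ltW s0).
- rewrite [X in is_derive _ _ _ X]/flat_exp t0/=.
  have t0' : t != 0 by rewrite gt_eqF.
  apply: (@near_eq_is_derive _ _ _ (fun s : R => P.[s^-1] * expR (- s^-1))).
    near=> s; rewrite /flat_exp ifT//.
    by near: s; exact: lt_nbhsr.
  have dV : is_derive t 1 (fun s : R => s^-1) (- (t^-2)).
    apply: (trigger_derive (@is_deriveV _ id t 1 1 t0' (is_derive_id t 1))).
    by rewrite /GRing.scale/= mulr1.
  have dP : is_derive t 1 (fun s : R => P.[s^-1]) (P^`().[t^-1] * - t^-2).
    by apply: (@is_derive1_comp _ (horner P) (fun s : R => s^-1)).
  have dE : is_derive t 1 (fun s : R => expR (- s^-1)) (expR (- t^-1) * - - t^-2).
    by apply: (@is_derive1_comp _ expR (fun s : R => - s^-1)).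
  apply: (trigger_derive (is_deriveM dP dE)).
  rewrite !hornerE /=/GRing.scale/=.
  by rewrite -exprVn; ring.
- rewrite [X in is_derive _ _ _ X]/flat_exp ltxx.
  suff h : (fun h : R => h^-1 *: ((flat_exp P \o shift 0) (h *: 1) - flat_exp P 0)) @ 0^' --> (0 : R).
    apply: DeriveDef; first by apply/cvg_ex; exists 0.
    exact/cvg_lim.
  (* With [y = 1/s] the difference quotient is [y P(y) exp(-y) = s (y^2 P(y) exp(-y))], hence at
     most [s * C] in absolute value. *)
  have [C hC] := poly_expR_bounded P 2.
  have C0 : 0 <= C by apply: le_trans (hC 0 (lexx _)); rewrite expr0n mulr0 mul0r.
  apply/cvgrPdist_le => e e0; near=> s.
  rewrite sub0r normrN /= /flat_exp ltxx subr0 /GRing.scale/= addr0 mulr1.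
  case: ifPn => [s0|_]; last by rewrite mulr0 normr0 ltW.
  have s0' : s != 0 by rewrite gt_eqF.
  have := hC s^-1; rewrite invr_ge0 => /(_ (ltW s0)) h.
  rewrite normrM (gtr0_norm (_ : 0 < s^-1)) ?invr_gt0// normrM (gtr0_norm (expR_gt0 _)).
  apply: (@le_trans _ _ (s * C)).
    rewrite -ler_pdivrMl//; apply: le_trans h; rewrite le_eqVlt; apply/orP; left; apply/eqP.
    by rewrite expr2; ring.
  (* [C] may be [0], so the division is by [C + 1]. *)
  have : `|s| < e / (C + 1).
    by near: s; apply: dnbhs0_lt; rewrite divr_gt0// ltr_wpDl.
  rewrite (gtr0_norm s0) ltr_pdivlMr ?ltr_wpDl// => /ltW.
  by apply: le_trans; rewrite ler_wpM2l ?ltW// ltrDl.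
Unshelve. all: by end_near. Qed.

Definition smooth (R : realType) (g : R -> R) :=
  forall n (y : R), derivable (derive1n n g) y 1.

Lemma smooth_antiderivative (R : realType) (g h : R -> R) :
  smooth h -> (forall y : R, is_derive y 1 g (h y)) -> smooth g.
Proof.
move=> sh gh.
have dg : derive1 g = h by apply/funext => y; rewrite derive1E derive_val.
case=> [|n] y; first exact: (@ex_derive _ _ _ _ _ _ _ (gh y)).
rewrite /derive1n iterSr dg; exact: sh.
Qed.

(* Stable under differentiation, so all its members are smooth. *)
Inductive flat_alg (R : realType) : (R -> R) -> Prop :=
| flat_alg_exp P c d : flat_alg (fun y => flat_exp P (c * y + d))
| flat_algD g h : flat_alg g -> flat_alg h -> flat_alg (g \+ h)
| flat_algM g h : flat_alg g -> flat_alg h -> flat_alg (g \* h).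

Lemma flat_exp_scale (R : realType) (P : {poly R}) (c t : R) :
  flat_exp P t * c = flat_exp (c *: P) t.
Proof.
rewrite /flat_exp; case: ifP => _; last by rewrite mul0r.
by rewrite hornerZ; ring.
Qed.

Lemma flat_alg_derive (R : realType) (g : R -> R) : flat_alg g ->
  exists2 h, flat_alg h & forall y : R, is_derive y 1 g (h y).
Proof.
elim=> {g} [P c d|g h _ [g' Ag' dg] _ [h' Ah' dh]|g h Ag [g' Ag' dg] Ah [h' Ah' dh]].
- exists (fun y => flat_exp (c *: ('X^2 * (P - P^`()))) (c * y + d)); first exact: flat_alg_exp.
  move=> y; rewrite -flat_exp_scale.
  have dl : is_derive y 1 (fun y : R => c * y + d) c.
    by apply: trigger_derive; rewrite /GRing.scale/= addr0 mulr1.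
  apply: (@is_derive1_comp _ (flat_exp P) (fun y : R => c * y + d)).
  exact: is_derive_flat_exp.
- by exists (g' \+ h'); [exact: flat_algD|move=> y; exact: is_deriveD].
- exists ((g \* h') \+ (h \* g')).
    by apply: flat_algD; exact: flat_algM.
  by move=> y; exact: is_deriveM.
Qed.

Lemma smooth_flat_alg (R : realType) (g : R -> R) : flat_alg g -> smooth g.
Proof.
move=> Ag n y.
suff : flat_alg (derive1n n g).
  by move=> /flat_alg_derive[h _ dh]; exact: (@ex_derive _ _ _ _ _ _ _ (dh y)).
elim: n => [//|n /flat_alg_derive[h Ah dh]].
suff <- : h = derive1n n.+1 g by [].
by apply/funext => z; rewrite /derive1n /= derive1E derive_val.
Qed.

(** * Smooth cutoffs of an interval and their primitives *)

Lemma Rintegral_dominated_cvg d (T : measurableType d) (R : realType)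
    (mu : {measure set T -> \bar R}) (D : set T) (g_ : nat -> T -> R) (g G : T -> R) :
  measurable D -> (forall n, measurable_fun D (g_ n)) -> measurable_fun D g ->
  (forall y, D y -> g_ n y @[n --> \oo] --> g y) ->
  mu.-integrable D (EFin \o G) ->
  (forall n y, D y -> `|g_ n y| <= G y) ->
  \int[mu]_(y in D) g_ n y @[n --> \oo] --> \int[mu]_(y in D) g y.
Proof.
move=> mD mg_ mg cg iG bg.
have [|||||ig _ h] := @dominated_convergence _ T R mu D mD (fun n => EFin \o g_ n) (EFin \o g)
  (EFin \o G).
- by move=> n; apply/measurable_EFinP.
- exact/measurable_EFinP.
- by apply: aeW => y Dy; apply: cvg_EFin; [exact: nearW|exact: cg].
- exact: iG.
- by apply: aeW => y n Dy; rewrite lee_fin; exact: bg.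
apply: fine_cvg; rewrite fineK//; exact: integrable_fin_num.
Qed.

(* Increases with [n] to the indicator of [`]p, q[]. *)
Definition cutoff (R : realType) (p q : R) (n : nat) (y : R) : R :=
  flat_exp 1 (n.+1%:R * y + - (n.+1%:R * p)) * flat_exp 1 (- n.+1%:R * y + n.+1%:R * q).

Section cutoff.
Variables (R : realType) (p q : R).
Local Notation mu := (@lebesgue_measure R).

Lemma flat_exp1_ge0 (t : R) : 0 <= flat_exp 1 t.
Proof. by rewrite /flat_exp; case: ifPn => // t0; rewrite hornerC mul1r expR_ge0. Qed.

Lemma flat_exp1_le1 (t : R) : flat_exp 1 t <= 1.
Proof.
rewrite /flat_exp; case: ifPn => t0 //.
by rewrite hornerC mul1r expR_le1 oppr_le0 invr_ge0 ltW.
Qed.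

Lemma cutoff_ge0 n y : 0 <= cutoff p q n y.
Proof. by rewrite mulr_ge0// flat_exp1_ge0. Qed.

Lemma cutoff_le1 n y : cutoff p q n y <= 1.
Proof. by rewrite mulr_ile1// ?flat_exp1_ge0// flat_exp1_le1. Qed.

Lemma cutoff_eq0 n y : y \notin `]p, q[ -> cutoff p q n y = 0.
Proof.
rewrite in_itv/= negb_and -!leNgt /cutoff /flat_exp => /orP[yp|qy].
  by rewrite -mulrN -mulrDr pmulr_rgt0// subr_gt0 ltNge yp/= mul0r.
rewrite [X in _ * X]ifN ?mulr0// mulNr addrC -mulrBr pmulr_rgt0//.
by rewrite subr_gt0 -leNgt.
Qed.

Lemma flat_exp1_cvg (t : R) : 0 < t ->
  flat_exp 1 (n.+1%:R * t) @[n --> \oo] --> (1 : R).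
Proof.
move=> t0.
have -> : (fun n => flat_exp 1 (n.+1%:R * t)) = (fun n => expR (- (n.+1%:R^-1 * t^-1))).
  apply/funext => n; rewrite /flat_exp pmulr_rgt0// t0 hornerC mul1r invfM//.
rewrite -[X in _ --> X]expR0; apply: continuous_cvg; first exact: continuous_expR.
rewrite -[X in _ --> X]oppr0; apply: cvgN.
rewrite -[X in _ --> X](mul0r t^-1); apply: cvgMl.
exact: cvg_harmonic.
Qed.

Lemma cutoff_cvg1 y : y \in `]p, q[ -> cutoff p q n y @[n --> \oo] --> (1 : R).
Proof.
rewrite in_itv/= => /andP[py yq].
rewrite -[X in _ --> X](mulr1 1); apply: cvgM.
  under eq_fun do rewrite -mulrN -mulrDr.
  by apply: flat_exp1_cvg; rewrite subr_gt0.
under eq_fun do rewrite mulNr addrC -mulrBr.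
by apply: flat_exp1_cvg; rewrite subr_gt0.
Qed.

Lemma flat_alg_cutoff n : flat_alg (cutoff p q n).
Proof. by apply: flat_algM; exact: flat_alg_exp. Qed.

Lemma continuous_cutoff n : continuous (cutoff p q n).
Proof.
have [h _ dh] := flat_alg_derive (flat_alg_cutoff n).
move=> y; apply/differentiable_continuous/derivable1_diffP.
exact: (@ex_derive _ _ _ _ _ _ _ (dh y)).
Qed.

Lemma measurable_cutoff n D : measurable_fun D (cutoff p q n).
Proof.
apply: measurable_funS (continuous_measurable_fun (@continuous_cutoff n)) => //.
Qed.

Lemma integrable_cutoff n : mu.-integrable setT (EFin \o cutoff p q n).
Proof.
apply: le_integrable (integrable_indic_itv p q false true) => //.
  by apply/measurable_EFinP; exact: measurable_cutoff.
move=> y _ /=; rewrite lee_fin ger0_norm ?cutoff_ge0// indicE.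
have [h|h] := boolP (y \in _); first by rewrite normr1 cutoff_le1.
rewrite normr0 cutoff_eq0//; apply: contra h => h.
by rewrite inE.
Qed.

(** A smooth step: [0] up to [p], constant from [q] on. Integrating from [-oo] lets the fundamental
    theorem apply at every real point, with no left endpoint to treat. *)
Definition cutoff_primitive n y := \int[mu]_(z in `]-oo, y]) cutoff p q n z.

Lemma is_derive_cutoff_primitive n (y : R) :
  is_derive y 1 (cutoff_primitive n) (cutoff p q n y).
Proof.
have [//| |//||d1 d2] := @continuous_FTC1 R (cutoff p q n) -oo%O y (y + 1).
- by rewrite ltrDl.
- by apply: integrableS (integrable_cutoff n).
- exact: ltNyr.
- exact: (@continuous_cutoff n y).
by apply: DeriveDef => //; rewrite -derive1E.
Qed.

Lemma cutoff_primitive_ge0 n y : 0 <= cutoff_primitive n y.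
Proof. by apply: Rintegral_ge0 => z _; exact: cutoff_ge0. Qed.

Lemma cutoff_primitive_homo n : {homo cutoff_primitive n : y z / y <= z}.
Proof.
move=> y z yz; rewrite /cutoff_primitive -lee_fin.
have h t : (\int[mu]_(x in `]-oo, t]) (cutoff p q n x)%:E)%E \is a fin_num.
  by apply: integrable_fin_num => //; apply: integrableS (integrable_cutoff n).
rewrite !fineK//; apply: ge0_subset_integral => //.
- by apply/measurable_EFinP; exact: measurable_cutoff.
- by move=> t _; rewrite lee_fin cutoff_ge0.
- by apply: subset_itvl; rewrite bnd_simp.
Qed.

Lemma cutoff_primitive_left n y : y <= p -> cutoff_primitive n y = 0.
Proof.
move=> yp; rewrite /cutoff_primitive (@eq_Rintegral _ _ _ _ _ (cst 0)) ?Rintegral_cst ?mul0r//.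
move=> z; rewrite inE/= in_itv/= => zy; apply: cutoff_eq0.
by rewrite in_itv/= negb_and -!leNgt (le_trans zy yp).
Qed.

Lemma cutoff_primitive_right n y : q <= y ->
  cutoff_primitive n y = \int[mu]_(z in `]p, q[) cutoff p q n z.
Proof.
move=> qy; rewrite /cutoff_primitive Rintegral_mkcond [RHS]Rintegral_mkcond.
congr Rintegral; apply/funext => z; rewrite !patchE.
case: ifPn => [_|zy]; case: ifPn => // zpq.
- by apply: cutoff_eq0; apply: contra zpq => zpq; rewrite inE.
- exfalso; move/negP: zy; apply; move: zpq; rewrite !inE/= !in_itv/= => /andP[_ zq].
  exact: le_trans (ltW zq) qy.
Qed.

Lemma cutoff_primitive_le n y : p <= q -> cutoff_primitive n y <= cutoff_primitive n q.
Proof.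
move=> pq; have [yq|qy] := leP y q; first exact: cutoff_primitive_homo.
by rewrite !cutoff_primitive_right// ltW.
Qed.

(** Dominated convergence with majorant [|g|], as the cutoffs lie between [0] and [1]. *)
Lemma Rintegral_cutoff_cvg (a b : R) (g : R -> R) : a <= p -> q <= b ->
  mu.-integrable `]a, b[ (EFin \o g) ->
  \int[mu]_(y in `]a, b[) (g y * cutoff p q n y) @[n --> \oo] -->
  \int[mu]_(y in `]p, q[) g y.
Proof.
move=> ap qb ig.
have mg : measurable_fun `]a, b[ g by apply/measurable_EFinP; exact: measurable_int ig.
have pqab : `]p, q[%classic `<=` `]a, b[%classic.
  by apply: subset_itvW.
have -> : \int[mu]_(y in `]p, q[) g y = \int[mu]_(y in `]a, b[) (g \_ `]p, q[) y.
  by rewrite -Rintegral_mkcondr; congr Rintegral; apply/esym/setIidPr.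
apply: (@Rintegral_dominated_cvg _ _ _ mu `]a, b[ _ _ (fun y => `|g y|)) => //.
- by move=> n; apply: measurable_funM => //; exact: measurable_cutoff.
- by apply/measurable_restrict => //; apply: measurable_funS mg => //.
- move=> y _; rewrite patchE; case: ifPn => [ypq|ypq].
    rewrite -[X in _ --> X]mulr1; apply: cvgMr; apply: cutoff_cvg1.
    by move: ypq; rewrite inE.
  rewrite (_ : (fun n => _) = cst 0); first exact: cvg_cst.
  apply/funext => n; rewrite cutoff_eq0 ?mulr0//.
  by apply: contra ypq => h; rewrite inE.
- exact: integrable_norm.
- move=> n y _; rewrite normrM ler_piMr// ger0_norm ?cutoff_ge0//.
  exact: cutoff_le1.
Qed.

End cutoff.

Lemma cutoffD (R : realType) (p q d : R) n y : cutoff (p + d) (q + d) n y = cutoff p q n (y - d).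
Proof. by rewrite /cutoff; congr (flat_exp _ _ * flat_exp _ _); ring. Qed.

Lemma smooth_cutoffB (R : realType) (p q d : R) n :
  smooth (fun y => cutoff p q n y - cutoff p q n (y - d)).
Proof.
apply: smooth_flat_alg.
(* [flat_alg] has no constructor for opposites, so the minus sign goes into the polynomial of one
   factor. *)
rewrite (_ : (fun y => _) = cutoff p q n \+ (fun y =>
  flat_exp (- 1%:P) (n.+1%:R * y + - (n.+1%:R * (p + d))) *
  flat_exp 1 (- n.+1%:R * y + n.+1%:R * (q + d)))).
  apply: flat_algD; first exact: flat_alg_cutoff.
  by apply: flat_algM; exact: flat_alg_exp.
apply/funext => y; rewrite -cutoffD /= /cutoff; congr (_ + _).
rewrite -mulNr; congr (_ * _).
rewrite -mulrN1 flat_exp_scale scaleN1r //.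
Qed.

(** * Limits along mollified trapezoids *)

Section trapezoid.
Context (R : realType).
Local Notation mu := (@lebesgue_measure R).

(* The conclusion is the hypothesis for [phi] the piecewise affine trapezoid with
   vertices [p], [p + h], [p + d], [p + d + h], which is not smooth; the test
   functions are mollified trapezoids.  For [d = h] it is a tent. *)
Lemma trapezoid_test_limit (a b p h d C K : R) (g : R -> R) :
  a < p -> 0 < h -> h <= d -> p + d + h < b ->
  mu.-integrable `]a, b[ (EFin \o g) ->
  (forall phi m, test_function a b phi ->
    (forall y, 0 <= phi y <= h) ->
    (forall y, y \notin `[p, p + d + h] -> phi y = 0) ->
    0 <= m <= h -> (forall y, p + h <= y <= p + d -> phi y = m) ->
    `|\int[mu]_(y in `]a, b[) (g y * derive1 phi y) + m * C| <= h * K) ->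
  `|\int[mu]_(y in `]p, p + h[) g y - \int[mu]_(y in `]p + d, p + d + h[) g y + h * C|
    <= h * K.
Proof.
move=> ap h0 hd phb ig H.
pose X n := cutoff_primitive p (p + h) n.
(* The plateau height of the mollified trapezoid, which tends to [h]. The factor [1] presents it as
   an instance of [Rintegral_cutoff_cvg]. *)
pose m n := \int[mu]_(y in `]p, p + h[) (1 * cutoff p (p + h) n y).
have mE n : m n = \int[mu]_(z in `]p, (p + h)[) cutoff p (p + h) n z.
  by rewrite /m; under eq_Rintegral do rewrite mul1r.
have pph : p <= p + h by rewrite lerDl ltW.
have ih : \int[mu]_(y in `]p, p + h[) 1 = h.
  rewrite Rintegral_cst// mul1r /= lebesgue_measure_itv/= lte_fin ltrDl h0/=.
  by rewrite addrAC subrr add0r.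
have i1 : mu.-integrable `]p, (p + h)[ (EFin \o cst 1).
  apply: measurable_bounded_integrable => //; last exact: bounded_cst.
  by rewrite /= lebesgue_measure_itv/=; case: ifP => _; rewrite -?EFinB ltry.
have cm : m n @[n --> \oo] --> h.
  rewrite -[X in _ --> X]ih.
  exact: (@Rintegral_cutoff_cvg R p (p + h) p (p + h) (cst 1)).
have mh n : m n <= h.
  rewrite -[leRHS]ih; apply: le_Rintegral => //.
    rewrite (_ : EFin \o _ = EFin \o cutoff p (p + h) n); last first.
      by apply/funext => y /=; rewrite mul1r.
    by apply: integrableS (integrable_cutoff p (p + h) n).
  by move=> y _; rewrite mul1r cutoff_le1.
have Xm n y : p + h <= y -> X n y = m n by move=> ?; rewrite mE /X cutoff_primitive_right.
have Xle n y : X n y <= m n.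
  by rewrite -(Xm n (p + h))//; exact: cutoff_primitive_le.
(* A step up over []p, p + h[] minus its translate by [d]. As [h <= d], the ramps do not overlap and
   [phi n] equals [m n] between them. *)
pose phi n y := X n y - X n (y - d).
pose theta n y := cutoff p (p + h) n y - cutoff p (p + h) n (y - d).
have dphi n (y : R) : is_derive y 1 (phi n) (theta n y).
  apply: is_deriveB; first exact: is_derive_cutoff_primitive.
  rewrite -[cutoff _ _ _ (y - d)]mulr1.
  apply: (@is_derive1_comp _ (X n) (fun y : R => y - d)).
    exact: is_derive_cutoff_primitive.
  by apply: (trigger_derive (is_deriveB (is_derive_id y 1) (is_derive_cst d y 1))); rewrite subr0.
have phi0 n y : y \notin `[p, p + d + h] -> phi n y = 0.
  rewrite in_itv/= negb_and -!ltNge /phi => /orP[yp|yq].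
    rewrite /X !cutoff_primitive_left ?subrr// ?ltW//.
    by rewrite (le_lt_trans _ yp)// gerBl (le_trans (ltW h0)).
  by rewrite !Xm ?subrr//; lra.
have tphi n : test_function a b (phi n).
  have sI : supp (phi n) `<=` `[p, p + d + h]%classic.
    have /closure_id cI : closed `[p, p + d + h]%classic by exact: interval_closed.
    rewrite /supp cI; apply: closure_subset => y /= /eqP; apply: contra_notP => /negP yI.
    exact: phi0.
  split.
  - by apply: smooth_antiderivative (dphi n); exact: smooth_cutoffB.
  - apply: subclosed_compact sI; [exact: closed_closure|exact: segment_compact].
  - apply: (subset_trans sI) => y /=; rewrite !in_itv/= => /andP[py yq].
    by rewrite (lt_le_trans ap py) (le_lt_trans yq phb).
(* The derivative of [phi n] is a cutoff of the first ramp minus a cutoff of the second, so each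
   half converges to the integral of [g] over its ramp. *)
have cint : \int[mu]_(y in `]a, b[) (g y * derive1 (phi n) y) + m n * C @[n --> \oo] -->
    \int[mu]_(y in `]p, p + h[) g y - \int[mu]_(y in `]p + d, p + d + h[) g y + h * C.
  apply: cvgD; last exact: cvgMl.
  rewrite (_ : (fun n => _) = fun n => \int[mu]_(y in `]a, b[) (g y * cutoff p (p + h) n y) -
    \int[mu]_(y in `]a, b[) (g y * cutoff (p + d) (p + d + h) n y)).
    by apply: cvgB; apply: Rintegral_cutoff_cvg => //; lra.
  apply/funext => n.
  have ic q1 q2 : mu.-integrable `]a, b[ (EFin \o (fun y => g y * cutoff q1 q2 n y)).
    apply: le_integrable (integrable_norm ig) => //.
      apply/measurable_EFinP; apply: measurable_funM; last exact: measurable_cutoff.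
      by apply/measurable_EFinP; exact: measurable_int ig.
    move=> y _ /=; rewrite lee_fin normr_id normrM ler_piMr// ger0_norm ?cutoff_ge0//.
    exact: cutoff_le1.
  rewrite -RintegralB//; apply: eq_Rintegral => y _.
  rewrite derive1E derive_val /theta mulrBr; congr (_ - _ * _).
  by rewrite addrAC cutoffD.
apply: (cvgr_to_le (cvg_norm cint)).
apply: nearW => n; apply: H => //.
- move=> y; rewrite /phi subr_ge0 cutoff_primitive_homo/= ?gerBl ?(le_trans (ltW h0))//.
  rewrite lerBlDr (le_trans (Xle n y))// (le_trans (mh n))// lerDl.
  exact: cutoff_primitive_ge0.
- exact: phi0.
- rewrite mh andbT mE; apply: Rintegral_ge0 => y _; exact: cutoff_ge0.
- move=> y /andP[y1 y2]; rewrite /phi Xm// /X cutoff_primitive_left ?subr0//; lra.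
Qed.

End trapezoid.

(** * Locality of the Jordan parts and of the total variation *)

Section charge_agreement.
Context d (T : measurableType d) (R : realType).
Implicit Types nu : {charge set T -> \bar R}.

Lemma jordan_posE0 nu P N (nuPN : hahn_decomposition nu P N) A : measurable A ->
  jordan_pos nuPN A = nu (A `&` P).
Proof. by move=> mA; rewrite jordan_posE cjordan_posE /crestr0 mem_set. Qed.

(** Cut the part of [A] in [P1] along [P2], [N2], and the part in [P2] along [P1], [N1]. The charges
    agree on the common piece; the other piece of the first has nonpositive mass, lying in [N2], and
    that of the second has nonnegative mass, lying in [P2]. *)
Lemma jordan_pos_le nu1 nu2 P1 N1 P2 N2 (h1 : hahn_decomposition nu1 P1 N1)
    (h2 : hahn_decomposition nu2 P2 N2) A : measurable A ->
  (forall B, measurable B -> B `<=` A -> nu1 B = nu2 B) ->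
  (jordan_pos h1 A <= jordan_pos h2 A)%E.
Proof.
move=> mA nu12; rewrite !jordan_posE0//.
have [[mP1 p1] [mN1 n1] PN1 PN10] := h1.
have [[mP2 p2] [mN2 n2] PN2 PN20] := h2.
rewrite (charge_partition nu1 (measurableI _ _ mA mP1) mP2 mN2 PN2 PN20).
rewrite (charge_partition nu2 (measurableI _ _ mA mP2) mP1 mN1 PN1 PN10).
apply: leeD.
  by rewrite setIAC nu12//; [do 2 apply: measurableI => //|move=> z [[]]].
apply: (@le_trans _ _ 0%E).
  rewrite nu12; [|by do 2 apply: measurableI => //|by move=> z [[]]].
  by apply: n2; [do 2 apply: measurableI => //|move=> z []].
by apply: p2; [do 2 apply: measurableI => //|move=> z [[]]].
Qed.

Lemma jordan_pos_agree nu1 nu2 P1 N1 P2 N2 (h1 : hahn_decomposition nu1 P1 N1)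
    (h2 : hahn_decomposition nu2 P2 N2) A : measurable A ->
  (forall B, measurable B -> B `<=` A -> nu1 B = nu2 B) ->
  jordan_pos h1 A = jordan_pos h2 A.
Proof.
move=> mA nu12; apply/eqP; rewrite eq_le !jordan_pos_le// => B mB BA.
by rewrite nu12.
Qed.

Lemma jordan_neg_agree nu1 nu2 P1 N1 P2 N2 (h1 : hahn_decomposition nu1 P1 N1)
    (h2 : hahn_decomposition nu2 P2 N2) A : measurable A ->
  (forall B, measurable B -> B `<=` A -> nu1 B = nu2 B) ->
  jordan_neg h1 A = jordan_neg h2 A.
Proof.
move=> mA nu12; have := nu12 A mA (fun _ => id).
rewrite (jordan_decomp h1 mA) (jordan_decomp h2 mA) /cadd/= !cscaleN1.
rewrite (jordan_pos_agree h1 h2 mA nu12).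
have : jordan_pos h2 A \is a fin_num by exact: fin_num_measure.
have : jordan_neg h1 A \is a fin_num by exact: fin_num_measure.
have : jordan_neg h2 A \is a fin_num by exact: fin_num_measure.
move=> f1 f2 f3 e; rewrite -(fineK f1) -(fineK f2); congr EFin.
apply: oppr_inj; apply: (addrI (fine (jordan_pos h2 A))).
by apply: EFin_inj; rewrite !EFinD !EFinN !fineK.
Qed.

Lemma tvar_agree nu1 nu2 A : measurable A ->
  (forall B, measurable B -> B `<=` A -> nu1 B = nu2 B) ->
  tvar nu1 A = tvar nu2 A.
Proof.
move=> mA nu12; rewrite /tvar/= /charge_variation.
by congr (_ + _)%E; [exact: jordan_pos_agree|exact: jordan_neg_agree].
Qed.

(** A point lies in exactly one of the two Hahn sets, so one Jordan part vanishes there and the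
    other is the absolute value of the mass. *)
Lemma tvar_set1 nu x : measurable [set x] -> tvar nu [set x] = `|nu [set x]|%E.
Proof.
move=> mx; rewrite -[LHS]/(jordan_pos (hahn_posneg nu) [set x] + jordan_neg (hahn_posneg nu) [set x])%E.
rewrite jordan_posE0// jordan_negE cjordan_negE /crestr0 mem_set// /crestr.
have [[mP p] [mN n] PN PN0] := hahn_posneg nu.
have [xP|xP] := pselect (hahn_pos nu x).
  have -> : [set x] `&` hahn_pos nu = [set x] by apply/setIidPl => _ ->.
  have -> : [set x] `&` hahn_neg nu = set0.
    rewrite -subset0 => z [/= -> xN].
    by have : (hahn_pos nu `&` hahn_neg nu) x by []; rewrite PN0.
  rewrite charge0 oppe0 !adde0 gee0_abs//.
  by apply: p => // _ ->.
have xN : hahn_neg nu x by have : setT x by []; rewrite -PN => -[].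
have -> : [set x] `&` hahn_pos nu = set0.
  by rewrite -subset0 => z [/= -> ].
have -> : [set x] `&` hahn_neg nu = [set x] by apply/setIidPl => _ ->.
rewrite charge0 !add0e lee0_abs//.
by apply: n => // _ ->.
Qed.

End charge_agreement.

(** * Splitting point masses off integrals against finite measures *)

Section integral_points.
Context d (T : measurableType d) (R : realType).
Variable m : {finite_measure set T -> \bar R}.

Lemma Rintegral_singleton (g : T -> R) x : measurable [set x] ->
  \int[m]_(y in [set x]) g y = g x * fine (m [set x]).
Proof.
move=> mx; rewrite -Rintegral_cst//; apply: eq_Rintegral => y.
by rewrite inE => ->.
Qed.

Lemma Rintegral_point (D : set T) (g : T -> R) x : measurable D -> measurable [set x] ->
  D x -> m.-integrable D (EFin \o g) ->
  \int[m]_(y in D) g y = g x * fine (m [set x]) + \int[m]_(y in D `\ x) g y.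
Proof.
move=> mD mx Dx ig; have DE : D = [set x] `|` (D `\ x).
  by rewrite setDUK// => _ ->.
rewrite {1}DE Rintegral_setU ?Rintegral_singleton//.
- exact: measurableD.
- by rewrite -DE.
- by apply/disj_setPS => z [/= -> []].
Qed.

Lemma bounded_finite_integrable (D : set T) (g : T -> R) M : measurable D ->
  measurable_fun D g -> (forall y, D y -> `|g y| <= M) -> m.-integrable D (EFin \o g).
Proof.
move=> mD mg gM; apply: measurable_bounded_integrable => //.
  by rewrite ltey_eq fin_num_measure.
exists M; split; first exact: num_real.
by move=> K MK y Dy; apply: (le_trans (gM y Dy)); exact: ltW.
Qed.

End integral_points.

Section finite_variation.
Context d (T : measurableType d) (R : realType) (nu : {charge set T -> \bar R}).
Variables (P N : set T) (nuPN : hahn_decomposition nu P N).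

Let finite_charge_variation : fin_num_fun (charge_variation nuPN).
Proof. by move=> A mA; exact: fin_num_measure. Qed.

(** The instance sits on [charge_variation], to which [tvar] unfolds; finite-measure lemmas are
    therefore applied to [charge_variation (hahn_posneg nu)]. *)
HB.instance Definition _ :=
  @Measure_isFinite.Build _ _ _ (charge_variation nuPN) finite_charge_variation.

End finite_variation.

(** * Adding opposite point masses at two points *)

Section jump_charge.
Context (R : realType).
Local Notation RR := (measurableTypeR R).
Implicit Types (nu : {charge set RR -> \bar R}) (D : set RR) (g : RR -> R) (p q : RR).

(** If [nu] is the derivative of [u], this is the derivative of [u] raised by [t] on []p, q[]. *)
Definition jump_charge nu (t p q : R) : {charge set RR -> \bar R} :=
  cadd nu (cadd (cscale t (charge_of_finite_measure (\d_(p : RR))))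
                (cscale (- t) (charge_of_finite_measure (\d_(q : RR))))).

Lemma jump_chargeE nu t p q A :
  jump_charge nu t p q A = (nu A + (t * \1_A p - t * \1_A q)%:E)%E.
Proof.
rewrite /jump_charge/= /cadd/= /cadd/= /cscale/= /charge_of_finite_measure/= /dirac.
by rewrite -!EFinM -EFinD mulNr.
Qed.

Lemma jump_charge_agree nu t p q B : ~ B p -> ~ B q -> jump_charge nu t p q B = nu B.
Proof.
by move=> Bp Bq; rewrite jump_chargeE !indicE !memNset// !mulr0 subr0 adde0.
Qed.

Lemma jump_charge_left nu t p q : p != q ->
  jump_charge nu t p q [set p] = (nu [set p] + t%:E)%E.
Proof.
move=> pq; rewrite jump_chargeE !indicE mem_set// memNset/=; last first.
  by move=> /= qp; rewrite qp eqxx in pq.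
by rewrite mulr1 mulr0 subr0.
Qed.

Lemma jump_charge_right nu t p q : p != q ->
  jump_charge nu t p q [set q] = (nu [set q] - t%:E)%E.
Proof.
move=> pq; rewrite jump_chargeE !indicE memNset/=; last first.
  by move=> /= qp; rewrite qp eqxx in pq.
by rewrite mem_set// mulr1 mulr0 sub0r.
Qed.

Lemma Rintegral_split2 (m : {finite_measure set RR -> \bar R}) D g p q M :
  measurable D -> D p -> D q -> p != q ->
  measurable_fun D g -> (forall y, D y -> `|g y| <= M) ->
  \int[m]_(y in D) g y = g p * fine (m [set p]) + g q * fine (m [set q]) +
    \int[m]_(y in D `\ p `\ q) g y.
Proof.
move=> mD Dp Dq pq mg gM.
have mDp : measurable (D `\ p) by exact: measurableD.
have Dpq : (D `\ p) q by split => // /= qp; rewrite qp eqxx in pq.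
have i1 : m.-integrable D (EFin \o g) by exact: bounded_finite_integrable gM.
have i2 : m.-integrable (D `\ p) (EFin \o g) by apply: integrableS i1 => // z [].
by rewrite (Rintegral_point mD _ Dp i1)// (Rintegral_point mDp _ Dpq i2)// addrA.
Qed.

Lemma charge_integral_split nu D g p q M : measurable D -> D p -> D q -> p != q ->
  measurable_fun D g -> (forall y, D y -> `|g y| <= M) ->
  charge_integral nu D g = g p * fine (nu [set p]) + g q * fine (nu [set q]) +
    charge_integral nu (D `\ p `\ q) g.
Proof.
move=> mD Dp Dq pq mg gM; rewrite /charge_integral.
rewrite (Rintegral_split2 (jordan_pos (hahn_posneg nu)) mD Dp Dq pq mg gM).
rewrite (Rintegral_split2 (jordan_neg (hahn_posneg nu)) mD Dp Dq pq mg gM).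
have nuE y : fine (nu [set y]) = fine (jordan_pos (hahn_posneg nu) [set y]) -
    fine (jordan_neg (hahn_posneg nu) [set y]).
  rewrite (jordan_decomp (hahn_posneg nu)) /cadd//= cscaleN1 fineD ?fineN//.
    exact: fin_num_measure.
  by rewrite fin_numN; exact: fin_num_measure.
rewrite !nuE; ring.
Qed.

Lemma charge_integral_agree nu1 nu2 D g : measurable D ->
  (forall B, measurable B -> B `<=` D -> nu1 B = nu2 B) ->
  charge_integral nu1 D g = charge_integral nu2 D g.
Proof.
move=> mD nu12; rewrite /charge_integral /Rintegral.
congr (fine _ - fine _); apply: eq_measure_integral => B mB BD.
  by apply: jordan_pos_agree => // C mC CB; apply: nu12 => //; exact: subset_trans BD.
by apply: jordan_neg_agree => // C mC CB; apply: nu12 => //; exact: subset_trans BD.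
Qed.

(** Jordan parts are not additive in the charge, so the integrals are not simply added: [p] and [q]
    are split off, where the masses are known, and on the rest the two charges agree. *)
Lemma charge_integral_jump nu D g t p q M : measurable D -> D p -> D q -> p != q ->
  measurable_fun D g -> (forall y, D y -> `|g y| <= M) ->
  charge_integral (jump_charge nu t p q) D g = charge_integral nu D g + t * (g p - g q).
Proof.
move=> mD Dp Dq pq mg gM.
rewrite !(charge_integral_split _ mD Dp Dq pq mg gM).
rewrite jump_charge_left// jump_charge_right//.
rewrite (@charge_integral_agree (jump_charge nu t p q) nu (D `\ p `\ q)); last first.
- move=> B mB BD; apply: jump_charge_agree => Bx.
    by have [[_ /=]] := BD _ Bx.
  by have [_ /=] := BD _ Bx.
- by do 2 apply: measurableD => //.
have fnu y : nu [set y] \is a fin_num by exact: fin_num_measure.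
by rewrite !fineD ?fin_numN ?fineN ?fnu//=; ring.
Qed.

Lemma tvar_split nu D g p q M : measurable D -> D p -> D q -> p != q ->
  measurable_fun D g -> (forall y, D y -> `|g y| <= M) ->
  \int[tvar nu]_(y in D) g y = g p * `|fine (nu [set p])| + g q * `|fine (nu [set q])| +
    \int[tvar nu]_(y in D `\ p `\ q) g y.
Proof.
move=> mD Dp Dq pq mg gM.
rewrite (Rintegral_split2 (charge_variation (hahn_posneg nu)) mD Dp Dq pq mg gM).
by rewrite -!fine_abse ?fin_num_measure// -!tvar_set1.
Qed.

(** Splitting off [p] and [q] gives an exact change of the weighted variation, where subadditivity
    would lose the decrease at a shrinking jump. *)
Lemma tvar_integral_jump nu D g t p q M : measurable D -> D p -> D q -> p != q ->
  measurable_fun D g -> (forall y, D y -> `|g y| <= M) ->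
  \int[tvar (jump_charge nu t p q)]_(y in D) g y = \int[tvar nu]_(y in D) g y +
    g p * (`|fine (nu [set p]) + t| - `|fine (nu [set p])|) +
    g q * (`|fine (nu [set q]) - t| - `|fine (nu [set q])|).
Proof.
move=> mD Dp Dq pq mg gM.
rewrite !(tvar_split _ mD Dp Dq pq mg gM).
rewrite jump_charge_left// jump_charge_right//.
have -> : \int[tvar (jump_charge nu t p q)]_(y in D `\ p `\ q) g y =
    \int[tvar nu]_(y in D `\ p `\ q) g y.
  rewrite /Rintegral; congr fine; apply: eq_measure_integral => B mB BD.
  apply: tvar_agree => // C mC CB; apply: jump_charge_agree => Cx.
    by have [[_ /=]] := BD _ (CB _ Cx).
  by have [_ /=] := BD _ (CB _ Cx).
have fnu y : nu [set y] \is a fin_num by exact: fin_num_measure.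
by rewrite !fineD ?fin_numN ?fineN ?fnu//=; ring.
Qed.

End jump_charge.

(** * Regularity of test functions and bounds for their integrals *)

Section test_functions.
Context (R : realType).
Local Notation mu := (@lebesgue_measure R).

Lemma test_function_continuous (a b : R) phi : test_function a b phi -> continuous phi.
Proof.
move=> [dphi _ _] y; apply/differentiable_continuous/derivable1_diffP.
exact: (dphi 0%N).
Qed.

Lemma test_function_derive_continuous (a b : R) phi : test_function a b phi ->
  continuous (derive1 phi).
Proof.
move=> [dphi _ _] y; apply/differentiable_continuous/derivable1_diffP.
exact: (dphi 1%N).
Qed.

Lemma within_continuous_bounded (a b : R) (g : R -> R) : {within `[a, b], continuous g} ->
  exists M, forall y, a <= y <= b -> `|g y| <= M.
Proof.
move=> cg; have [M [_ hM]] := compact_bounded (continuous_compact cg (@segment_compact _ a b)).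
(* [compact_bounded] gives the bound for every number strictly above [M], hence [M + 1]. *)
exists (M + 1) => y yab; apply: (hM (M + 1)); first by rewrite ltrDl.
by exists y => //=; rewrite in_itv.
Qed.

Lemma continuous_bounded_itv (a b : R) (g : R -> R) : continuous g ->
  exists M, forall y, y \in `]a, b[ -> `|g y| <= M.
Proof.
move=> cg; have [M hM] := within_continuous_bounded (continuous_subspaceT cg : {within `[a, b], continuous g}).
by exists M => y; rewrite in_itv/= => /andP[ay yb]; apply: hM; rewrite !ltW.
Qed.

Lemma integrableM_continuous (a b : R) (g h : R -> R) :
  mu.-integrable `]a, b[ (EFin \o g) -> continuous h ->
  mu.-integrable `]a, b[ (EFin \o (fun y => g y * h y)).
Proof.
move=> ig ch; have [M hM] := continuous_bounded_itv a b ch.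
have mg : measurable_fun `]a, b[ g by apply/measurable_EFinP; exact: measurable_int ig.
apply: (@le_integrable _ _ _ mu _ _ _ (EFin \o (fun y => M * `|g y|))) => //.
- apply/measurable_EFinP; apply: measurable_funM => //.
  exact: measurable_funS (continuous_measurable_fun ch).
- move=> y yab; rewrite /= lee_fin normrM mulrC.
  rewrite [leRHS]ger0_norm ?mulr_ge0// ?(le_trans _ (hM y yab))//.
  by rewrite ler_wpM2r// hM.
- by apply: (integrableZl _ M (integrable_norm ig)).
Qed.

End test_functions.

Section charge_integral_bound.
Context (R : realType).
Local Notation RR := (measurableTypeR R).

Lemma Rintegral_le_supp (m : {finite_measure set RR -> \bar R}) (D E : set RR) (g : RR -> R) (h : R) :
  measurable D -> measurable E -> measurable_fun D g -> 
  (forall y, D y -> 0 <= g y <= h) -> (forall y, D y -> ~ E y -> g y = 0) ->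
  0 <= \int[m]_(y in D) g y <= h * fine (m (D `&` E)).
Proof.
move=> mD mE mg gh g0; apply/andP; split.
  by apply: Rintegral_ge0 => y /gh/andP[].
have -> : \int[m]_(y in D) g y = \int[m]_(y in D `&` E) g y.
  rewrite Rintegral_mkcondr; apply: eq_Rintegral => y; rewrite inE => Dy.
  rewrite patchE; case: ifPn => // yE; apply: g0 => // Ey.
  by move: yE; rewrite mem_set.
have mDE : measurable (D `&` E) by exact: measurableI.
rewrite -Rintegral_cst//; apply: le_Rintegral => //.
- apply: (@bounded_finite_integrable _ _ _ _ _ _ h) => //.
    by apply: measurable_funS mg.
  by move=> y [/gh/andP[g0' gh'] _]; rewrite ger0_norm.
- by apply: (@bounded_finite_integrable _ _ _ _ _ _ `|h|).
- by move=> y [/gh/andP[]].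
Qed.

End charge_integral_bound.

(** * Jumps, the fundamental theorem and step perturbations for weak derivatives *)

Section derivatives_of_bv.
Context (R : realType).
Local Notation RR := (measurableTypeR R).
Local Notation mu := (@lebesgue_measure R).
Implicit Types (D : {charge set RR -> \bar R}).

(** Against a tent of height at most [h], the atom at [x] contributes the peak value times its mass,
    and the rest at most [h] times the variation of the punctured interval. By [tvar_punctured_cvg]
    this error is [o(h)]. *)
Lemma jump_estimate (a b x h : R) (g : R -> R) D :
  mu.-integrable `]a, b[ (EFin \o g) -> distributional_derivative a b g D ->
  0 < h -> a < x - h -> x + h < b ->
  `|\int[mu]_(y in `]x - h, x[) g y - \int[mu]_(y in `]x, x + h[) g y +
     h * fine (D [set x])| <= h * fine (tvar D (`[x - h, x + h] `\ x)).
Proof.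
move=> ig gD h0 ah hb.
have := @trapezoid_test_limit R a b (x - h) h h (fine (D [set x]))
  (fine (tvar D (`[x - h, x + h] `\ x))) g.
rewrite subrK; apply => // phi m tphi phih phi0 mh phim.
(* The ramp width equals the shift, so the plateau is the single point [x]. *)
have mx : phi x = m by apply: phim; rewrite lexx.
have cphi := test_function_continuous tphi.
have mphi B : measurable_fun B phi by exact: measurable_funS (continuous_measurable_fun cphi).
have xab : `]a, b[%classic x by rewrite /= in_itv/=; lra.
rewrite gD// /charge_integral.
have mab : measurable (`]a, b[%classic : set RR) by exact: measurable_itv.
have S (n : {finite_measure set RR -> \bar R}) :
    \int[n]_(y in `]a, b[) phi y = phi x * fine (n [set x]) + \int[n]_(y in `]a, b[ `\ x) phi y.
  apply: Rintegral_point => //.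
  apply: (@bounded_finite_integrable _ RR R n _ phi h mab (mphi _)) => y _.
  by have /andP[? ?] := phih y; rewrite ger0_norm.
rewrite (S (jordan_pos (hahn_posneg D))) (S (jordan_neg (hahn_posneg D))).
have mI : measurable (`[x - h, x + h]%classic : set RR) by exact: measurable_itv.
have mabx : measurable (`]a, b[%classic `\ x : set RR) by exact: measurableD.
have B (n : {finite_measure set RR -> \bar R}) :
    0 <= \int[n]_(y in `]a, b[ `\ x) phi y <= h * fine (n (`[x - h, x + h] `\ x)).
  have -> : `[x - h, x + h] `\ x = (`]a, b[%classic `\ x) `&` `[x - h, x + h]%classic.
    apply/seteqP; split=> z /=; rewrite !in_itv/=.
      by move=> [zI zx]; split => //; split => //; lra.
    by move=> [[_ zx] zI].
  apply: (@Rintegral_le_supp R n (`]a, b[%classic `\ x) `[x - h, x + h]%classic phi h mabx mI (mphi _)) => //.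
  by move=> y _ yI; apply: phi0; exact/negP.
have := B (jordan_pos (hahn_posneg D)); have := B (jordan_neg (hahn_posneg D)).
rewrite mx (_ : fine (tvar D _) = fine (jordan_pos (hahn_posneg D) (`[x - h, x + h] `\ x)) +
  fine (jordan_neg (hahn_posneg D) (`[x - h, x + h] `\ x))); last first.
  rewrite -fineD; [by []| |]; apply: fin_num_measure; exact: measurableD.
rewrite (_ : fine (D [set x]) = fine (jordan_pos (hahn_posneg D) [set x]) -
    fine (jordan_neg (hahn_posneg D) [set x])); last first.
  rewrite (jordan_decomp (hahn_posneg D)) /cadd//= cscaleN1 fineD ?fineN//.
    exact: fin_num_measure.
  by rewrite fin_numN; exact: fin_num_measure.
set ip := Rintegral _ _ _; set i_n := Rintegral _ _ _.
set A := fine _; set B' := fine _; set A' := fine _; set B'' := fine _.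
move=> /andP[h1 h2] /andP[h3 h4].
rewrite ler_norml; apply/andP; split; lra.
Qed.

Lemma cvg_divS (r : R) : r * n.+1%:R^-1 @[n --> \oo] --> (0 : R).
Proof. by rewrite -[X in _ --> X](mulr0 r); apply: cvgMr; exact: cvg_harmonic. Qed.

Lemma divS_gt0 (r : R) n : 0 < r -> 0 < r * n.+1%:R^-1.
Proof. by move=> r0; rewrite mulr_gt0. Qed.

Lemma divS_le (r : R) n : 0 < r -> r * n.+1%:R^-1 <= r.
Proof. by move=> r0; rewrite ger_pMr// invf_le1// ler1n. Qed.

Lemma divS_homo (r : R) m n : 0 < r -> (m <= n)%N -> r * n.+1%:R^-1 <= r * m.+1%:R^-1.
Proof. by move=> r0 mn; rewrite ler_pM2l// lef_pV2 ?posrE// ler_nat. Qed.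

(** The punctured intervals decrease to the empty set and the variation is finite: continuity from
    above. *)
Lemma tvar_punctured_cvg (x r : R) D : 0 < r ->
  fine (tvar D (`[x - r * n.+1%:R^-1, x + r * n.+1%:R^-1] `\ x)) @[n --> \oo] --> (0 : R).
Proof.
move=> r0; pose F n : set RR := `[x - r * n.+1%:R^-1, x + r * n.+1%:R^-1] `\ x.
have mF n : measurable (F n) by apply: measurableD.
have F0 : \bigcap_n F n = set0.
  rewrite -subset0 => y Fy; have [_ yx] := Fy 0%N I.
  have yx0 : 0 < `|(y : R) - x| by rewrite normr_gt0 subr_eq0; exact/eqP.
  have [n _ hn] := (cvgr0Pnorm_lt _).1 (cvg_divS r) _ yx0.
  have := hn n (leqnn _); rewrite gtr0_norm ?divS_gt0// => {}hn.
  have [/= + _] := Fy n I; rewrite in_itv/= => /andP[h1 h2].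
  by move: hn; rewrite ltNge => /negP; apply; rewrite ler_norml lerBlDl h2 lerBrDl h1.
have := @nonincreasing_cvg_mu _ RR R (tvar D) F.
rewrite F0 measure0 => h.
apply: (@fine_cvg _ _ _ _ _ 0); apply: h => //.
- by rewrite ltey_eq fin_num_measure.
- move=> m n mn; apply/subsetPset => y [/= + yx]; rewrite in_itv/= => /andP[h1 h2].
  split => //=; rewrite in_itv/=; have mnr := divS_homo r0 mn.
  by rewrite (le_trans _ h1) ?(le_trans h2)// ?lerD2l ?lerN2.
Qed.

(** Every interval contains [p], so the restrictions of [|g|] tend pointwise to its restriction to
    [[set p]], a null set; [|g|] dominates them. *)
Lemma cvg_integral_shrink (a b p r : R) (g : R -> R) : a < p -> p + r < b -> 0 < r ->
  mu.-integrable `]a, b[ (EFin \o g) ->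
  \int[mu]_(y in `[p, p + r * n.+1%:R^-1]) `|g y| @[n --> \oo] --> (0 : R).
Proof.
move=> ap rb r0 ig.
have sub n : `[p, p + r * n.+1%:R^-1]%classic `<=` `]a, b[%classic.
  move=> y /=; rewrite !in_itv/=; have := divS_le n r0.
  by move: (r * _) => t h /andP[h1 h2]; apply/andP; split; lra.
have pab : [set p] `<=` `]a, b[%classic by move=> _ ->; rewrite /= in_itv/=; apply/andP; split; lra.
rewrite -[X in _ --> X](@Rintegral_set1 _ (fun y => `|g y|) p).
have E (A : set R) : A `<=` `]a, b[%classic ->
    \int[mu]_(y in A) `|g y| = \int[mu]_(y in `]a, b[) ((fun y => `|g y|) \_ A) y.
  by move=> AI; rewrite -Rintegral_mkcondr; congr Rintegral; apply/esym/setIidPr.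
rewrite (E [set p])//; under eq_fun do rewrite E//.
have mg : measurable_fun `]a, b[ (fun y => `|g y|).
  apply: measurableT_comp => //; apply/measurable_EFinP; exact: measurable_int ig.
apply: (@Rintegral_dominated_cvg _ _ _ mu `]a, b[ _ _ (fun y => `|g y|)) => //.
- by move=> n; apply/measurable_restrict => //; exact: measurable_funS mg.
- by apply/measurable_restrict => //; exact: measurable_funS mg.
- move=> y _; rewrite [X in _ --> X]patchE; case: ifPn => yp.
    move: yp; rewrite inE/= => ->.
    rewrite (_ : (fun n => _) = cst `|g p|); first exact: cvg_cst.
    apply/funext => n; rewrite patchE mem_set//= in_itv/= lexx lerDl ltW// divS_gt0//.
  have yx0 : 0 < `|y - p|.
    by rewrite normr_gt0 subr_eq0; apply/eqP => yE; rewrite yE mem_set in yp.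
  have := (cvgr0Pnorm_lt _).1 (cvg_divS r) _ yx0 => hn.
  apply: cvg_near_cst; near=> n.
  rewrite patchE memNset//= in_itv/= => /andP[h1 h2].
  have : `|r * n.+1%:R^-1| < `|y - p| by near: n; exact: hn.
  rewrite ltNge => /negP; apply.
  by rewrite (gtr0_norm (divS_gt0 n r0)) ger0_norm ?subr_ge0// lerBlDr addrC.
- exact: integrable_norm.
- move=> n y _; rewrite patchE; case: ifPn => _; by rewrite ?normr_id ?normr0.
Unshelve. all: by end_near. Qed.

Lemma cvg_average (p r : R) (g : R -> R) : 0 < r -> {for p, continuous g} ->
  mu.-integrable `]p, p + r[ (EFin \o g) ->
  (r * n.+1%:R^-1)^-1 * \int[mu]_(y in `]p, p + r * n.+1%:R^-1[) g y @[n --> \oo] --> g p.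
Proof.
move=> r0 cg ig; apply/cvgrPdist_le => e e0.
have [d d0 hd] : exists2 d, 0 < d & forall y, `|p - y| < d -> `|g p - g y| <= e.
  by have /cvgrPdist_le/(_ e e0)[d d0 hd] := cg; exists d.
near=> n.
have hd' : `|r * n.+1%:R^-1| < d by near: n; exact: (cvgr0Pnorm_lt _).1 (cvg_divS r) _ d0.
move: hd'; set h := r * n.+1%:R^-1 => hd'.
have h0 : 0 < h by exact: divS_gt0.
rewrite gtr0_norm// in hd'.
have hr : h <= r by exact: divS_le.
have muh : fine (mu `]p, p + h[) = h.
  by rewrite /= lebesgue_measure_itv/= lte_fin ltrDl h0/= addrAC subrr add0r.
have ic c : mu.-integrable `]p, (p + h)[ (EFin \o cst c).
  apply: measurable_bounded_integrable => //; last exact: bounded_cst.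
  by rewrite /= lebesgue_measure_itv/=; case: ifP => _; rewrite -?EFinB ltry.
have igh : mu.-integrable `]p, (p + h)[ (EFin \o g).
  by apply: integrableS ig => //; apply: subset_itvl; rewrite bnd_simp lerD2l.
have -> : g p - h^-1 * \int[mu]_(y in `]p, p + h[) g y =
    h^-1 * \int[mu]_(y in `]p, p + h[) (g p - g y).
  rewrite (RintegralB _ (ic (g p)))// mulrBr; congr (_ - _).
  by rewrite Rintegral_cst// muh mulrCA mulVf ?mulr1// gt_eqF.
rewrite normrM (gtr0_norm (_ : 0 < h^-1)) ?invr_gt0// ler_pdivrMl//.
have ib : mu.-integrable `]p, (p + h)[ (EFin \o (fun y => g p - g y)).
  exact: (integrableB _ (ic (g p)) igh).
apply: (le_trans (le_normr_Rintegral _ ib)) => //.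
apply: (@le_trans _ _ (\int[mu]_(y in `]p, p + h[) cst e y)).
  apply: le_Rintegral => //; first exact: integrable_norm.
  move=> y /=; rewrite in_itv/= => /andP[h1 h2]; apply: hd.
  by rewrite distrC gtr0_norm ?subr_gt0// (lt_trans _ hd')// ltrBlDl.
by rewrite Rintegral_cst// muh mulrC.
Unshelve. all: by end_near. Qed.

(** Test with a trapezoid rising just after [p] and falling just after [q]. Divided by the ramp
    width, the side with [g] gives averages that tend to [g p] and [g q] by continuity, and the
    other side gives the integral of [g'] over [[p, q]] up to an error on the ramps. *)
Lemma weak_derivative_ftc (a b p q : R) (g g' : R -> R) : a < p -> p < q -> q < b ->
  {within `[a, b], continuous g} -> mu.-integrable `]a, b[ (EFin \o g') ->
  weak_derivative a b g g' ->
  g q - g p = \int[mu]_(y in `[p, q]) g' y.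
Proof.
move=> ap pq qb cg ig' [_ wg].
have ab : a < b by lra.
have ig : mu.-integrable `]a, b[ (EFin \o g).
  have igc : mu.-integrable `[a, b] (EFin \o g).
    by apply: continuous_compact_integrable => //; exact: segment_compact.
  by apply: integrableS igc => //; exact: subset_itv_oo_cc.
have cgy y : a < y < b -> {for y, continuous g}.
  by move=> yab; apply: within_continuous_continuous cg _ => //; rewrite in_itv.
(* The bound [q - p] keeps the ramps disjoint; half of [b - q] keeps the second ramp strictly inside
   []a, b[]. *)
pose r := Num.min (q - p) ((b - q) / 2).
have r0 : 0 < r by rewrite /r lt_min; apply/andP; split; lra.
have rqp : r <= q - p by rewrite /r ge_min lexx.
have rqb : q + r < b.
  have : r <= (b - q) / 2 by rewrite /r ge_min lexx orbT.
  lra.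
set C := \int[mu]_(y in `[p, q]) g' y.
pose h n := r * n.+1%:R^-1.
(* The trapezoid and [m] times the indicator of [[p, q]] differ only on the two ramps, by at most
   [h n]. *)
pose K n := \int[mu]_(y in `[p, p + h n]) `|g' y| + \int[mu]_(y in `[q, q + h n]) `|g' y|.
have est n : `|\int[mu]_(y in `]p, p + h n[) g y - \int[mu]_(y in `]q, q + h n[) g y + h n * C|
    <= h n * K n.
  have h0 : 0 < h n by exact: divS_gt0.
  have hr : h n <= r by exact: divS_le.
  have := @trapezoid_test_limit R a b p (h n) (q - p) C (K n) g.
  rewrite addrCA subrr addr0; apply => //; [lra|lra|].
  move=> phi m tphi phih phi0 /andP[m0 mh] phim.
  rewrite wg//.
  have cphi := test_function_continuous tphi.
  have sub (x y : R) : a < x -> y < b -> `[x, y]%classic `<=` `]a, b[%classic.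
    move=> ax yb z /=; rewrite !in_itv/= => /andP[h1 h2]; apply/andP; split; lra.
  have E (f : R -> R) (x y : R) : a < x -> y < b ->
      \int[mu]_(z in `[x, y]) f z = \int[mu]_(z in `]a, b[) (f \_ `[x, y]) z.
    by move=> ax yb; rewrite -Rintegral_mkcondr; congr Rintegral; apply/esym/setIidPr/sub.
  have iE (f : R -> R) (x y : R) : mu.-integrable `]a, b[ (EFin \o f) ->
      mu.-integrable `]a, b[ (EFin \o (f \_ `[x, y])).
    move=> jf; rewrite -restrict_EFin; apply/integrable_restrict => //.
    by apply: integrableS jf => //; exact: measurableI.
  have ign := integrable_norm ig'.
  rewrite /C /K !E; try lra.
  have i1 := integrableM_continuous ig' cphi.
  have i2 := iE _ p q ig'.
  have i3 := iE _ p (p + h n) ign.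
  have i4 := iE _ q (q + h n) ign.
  have mab : measurable (`]a, b[%classic : set RR) by exact: measurable_itv.
  pose c1 := g' \_ `[p, q]; pose c3 := (Num.Def.normr \o g') \_ `[p, p + h n].
  pose c4 := (Num.Def.normr \o g') \_ `[q, q + h n].
  have i5 : mu.-integrable `]a, b[ (EFin \o (fun y => m * c1 y)) := integrableZl mab m i2.
  have i6 : mu.-integrable `]a, b[ (EFin \o (fun y => m * c1 y - g' y * phi y)) :=
    integrableB mab i5 i1.
  have i7 : mu.-integrable `]a, b[ (EFin \o (fun y => c3 y + c4 y)) := integrableD mab i3 i4.
  have i8 : mu.-integrable `]a, b[ (EFin \o (fun y => h n * (c3 y + c4 y))) :=
    integrableZl mab (h n) i7.
  rewrite addrC -(RintegralZl m mab i2) -(RintegralB mab i5 i1).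
  rewrite -(RintegralD mab i3 i4) -(RintegralZl (h n) mab i7).
  apply: le_trans (le_normr_Rintegral mab i6) _.
  apply: (le_Rintegral mab (integrable_norm i6) i8) => y _ /=.
  have hg : 0 <= h n * `|g' y| by rewrite mulr_ge0// ltW.
  have R3 : 0 <= h n * c3 y.
    by rewrite /c3 patchE; case: ifPn => _; rewrite ?mulr0//.
  have R4 : 0 <= h n * c4 y.
    by rewrite /c4 patchE; case: ifPn => _; rewrite ?mulr0//.
  have bound c z : 0 <= c <= h n -> 0 <= z <= h n -> `|c * g' y - g' y * z| <= h n * `|g' y|.
    move=> /andP[c0 ch] /andP[z0 zh].
    rewrite mulrC -mulrBr normrM mulrC ler_wpM2r// ler_norml; apply/andP; split; lra.
  (* From left to right: before the support, first ramp, plateau, second ramp, after the support.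
     Only the ramps contribute. *)
  have [yp|py] := ltP y p.
    rewrite /c1 patchE memNset/= ?in_itv/=; last by move=> /andP[]; rewrite leNgt yp.
    rewrite phi0 ?in_itv/=; last by rewrite leNgt yp.
    by rewrite !mulr0 subrr normr0 mulrDr addr_ge0.
  have [yq|qy] := leP y q.
    rewrite /c1 patchE mem_set/= ?in_itv/= ?py ?yq//.
    have [yph|phy] := ltP y (p + h n).
      rewrite mulrDr ler_wpDr// /c3 patchE mem_set/= ?in_itv/= ?py ?(ltW yph)//.
      by apply: bound; rewrite ?m0 ?mh//.
    rewrite phim ?phy ?yq// mulrC subrr normr0 mulrDr addr_ge0//.
  rewrite /c1 patchE memNset/= ?in_itv/=; last by move=> /andP[_]; rewrite leNgt qy.
  have [yqh|qhy] := leP y (q + h n).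
    rewrite mulrDr ler_wpDl// /c4 patchE mem_set/= ?in_itv/= ?(ltW qy) ?yqh//.
    by have := bound 0 (phi y); rewrite mul0r mulr0; apply => //; rewrite lexx ltW.
  rewrite phi0 ?in_itv/=; last by rewrite negb_and -!ltNge qhy orbT.
  by rewrite !mulr0 subrr normr0 mulrDr addr_ge0.
have cK : K n @[n --> \oo] --> (0 : R).
  rewrite -[X in _ --> X](addr0 0).
  by apply: cvgD; apply: (cvg_integral_shrink _ _ r0 ig') => //; lra.
have iS (x : R) : a < x -> x + r < b -> mu.-integrable `]x, x + r[ (EFin \o g).
  move=> ax xb; apply: integrableS ig => //= z /=.
  by rewrite !in_itv/= => /andP[h1 h2]; apply/andP; split; lra.
have cA := cvg_average r0 (cgy p _) (iS p ap _).
have cB := cvg_average r0 (cgy q _) (iS q _ rqb).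
have cAB : `|(h n)^-1 * \int[mu]_(y in `]p, p + h n[) g y -
    (h n)^-1 * \int[mu]_(y in `]q, q + h n[) g y + C| @[n --> \oo] --> `|g p - g q + C|.
  apply: cvg_norm; apply: cvgD; last exact: cvg_cst.
  by apply: cvgB; [apply: cA|apply: cB]; rewrite ?ap ?qb ?andbT//=; lra.
(* Divide [est] by [h n] and pass to the limit. *)
have : `|g p - g q + C| <= 0.
  apply: (ler_cvg_to cAB cK); apply: nearW => n.
  have h0 : 0 < h n by exact: divS_gt0.
  rewrite -(ler_pM2l h0) -[X in X * `|_|](gtr0_norm h0) -normrM.
  rewrite mulrDr mulrBr !mulrA mulfV ?gt_eqF// !mul1r.
  exact: est.
by rewrite normr_le0 => /eqP; lra.
Qed.

Lemma Rintegral_derive_test (a b p q : R) phi : p < q -> test_function a b phi ->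
  \int[mu]_(y in `]p, q[) derive1 phi y = phi q - phi p.
Proof.
move=> pq tphi; have cphi' := test_function_derive_continuous tphi.
have cphi := test_function_continuous tphi.
have := @continuous_FTC2 R (derive1 phi) phi p q pq (continuous_subspaceT cphi').
have dd : derivable_oo_LRcontinuous phi p q.
  split.
  - by move=> y _; case: tphi => /(_ 0%N y).
  - exact/cvg_at_right_filter/cphi.
  - exact/cvg_at_left_filter/cphi.
move=> /(_ dd (fun _ _ => erefl)) E.
rewrite Rintegral_itv_bndo_bndc; last first.
  apply: (@integrableS _ _ _ mu `[p, q]) => //; first exact: subset_itvW.
  by apply: continuous_compact_integrable; [exact: segment_compact|exact: continuous_subspaceT].
rewrite Rintegral_itv_obnd_cbnd; last first.
  apply: (@integrableS _ _ _ mu `[p, q]) => //; first exact: subset_itv_oc_cc.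
  by apply: continuous_compact_integrable; [exact: segment_compact|exact: continuous_subspaceT].
by rewrite /Rintegral E.
Qed.

(** The added step contributes [t * (phi q - phi p)], which is minus the integral of [phi] against
    the two added point masses. *)
Lemma distributional_derivative_jump (a b p q t : R) (u : R -> R) D : a < p -> p < q -> q < b ->
  mu.-integrable `]a, b[ (EFin \o u) -> distributional_derivative a b u D ->
  distributional_derivative a b (fun y => u y + t * \1_(`]p, q[%classic) y) (jump_charge D t p q).
Proof.
move=> ap pq qb iu uD phi tphi.
have cphi' := test_function_derive_continuous tphi.
have cphi := test_function_continuous tphi.
have [M hM] := continuous_bounded_itv a b cphi.
have mab : measurable (`]a, b[%classic : set RR) by exact: measurable_itv.
have pab : `]a, b[%classic p by rewrite /= in_itv/=; lra.
have qab : `]a, b[%classic q by rewrite /= in_itv/=; lra.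
have mphi : measurable_fun `]a, b[ phi.
  exact: measurable_funS (continuous_measurable_fun cphi).
have npq : p != q by rewrite lt_eqF.
rewrite (charge_integral_jump D t mab pab qab npq mphi hM).
have i1 := integrableM_continuous iu cphi'.
have i1' : mu.-integrable `]a, b[ (EFin \o cst 1).
  apply: measurable_bounded_integrable => //; last exact: bounded_cst.
  by rewrite /= lebesgue_measure_itv/=; case: ifP => _; rewrite -?EFinB ltry.
have i2 : mu.-integrable `]a, b[ (EFin \o ((derive1 phi) \_ `]p, q[)).
  rewrite -restrict_EFin; apply/integrable_restrict => //.
  have i3 := integrableM_continuous i1' cphi'.
  have i4 : mu.-integrable `]a, b[ (EFin \o (derive1 phi)).
    by apply: eq_integrable i3 => // y _ /=; rewrite mul1r.
  by apply: integrableS i4 => //; exact: measurableI.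
have i3 : mu.-integrable `]a, b[ (EFin \o (fun y => t * ((derive1 phi) \_ `]p, q[) y)).
  exact: (integrableZl _ t i2).
rewrite (_ : \int[mu]_(x in `]a, b[) _ = \int[mu]_(x in `]a, b[) (u x * derive1 phi x) +
   t * \int[mu]_(y in `]p, q[) derive1 phi y).
  rewrite uD// (Rintegral_derive_test pq tphi); ring.
have -> : \int[mu]_(y in `]p, q[) derive1 phi y =
    \int[mu]_(y in `]a, b[) ((derive1 phi) \_ `]p, q[) y.
  rewrite -Rintegral_mkcondr; congr Rintegral; apply/esym/setIidPr => z /=.
  by rewrite !in_itv/=; lra.
rewrite -RintegralZl// -RintegralD//; apply: eq_Rintegral => y _.
rewrite mulrDl -mulrA; congr (_ + _ * _); rewrite patchE indicE.
by case: ifPn => _; rewrite ?mul1r ?mul0r.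
Qed.

End derivatives_of_bv.

(** * First variation of the energy under a step perturbation *)

Section energy_variation.
Context (R : realType).
Local Notation RR := (measurableTypeR R).
Local Notation mu := (@lebesgue_measure R).
Variables (a b : R) (f alpha : R -> R).
Hypotheses (int_f : mu.-integrable `]a, b[ (EFin \o f)).
Hypotheses (alpha_cont : {within `[a, b], continuous alpha})
  (alpha_gt0 : forall y, a <= y <= b -> 0 < alpha y).
Implicit Types (D : {charge set RR -> \bar R}).

Lemma measurable_weight : measurable_fun `]a, b[ alpha.
Proof.
have : measurable_fun `[a, b] alpha by exact: subspace_continuous_measurable_fun.
by apply: measurable_funS => //; exact: subset_itv_oo_cc.
Qed.

Lemma integrable_weight (m : {finite_measure set RR -> \bar R}) :
  m.-integrable `]a, b[ (EFin \o alpha).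
Proof.
have [M hM] := within_continuous_bounded alpha_cont.
have mab : measurable (`]a, b[%classic : set RR) by exact: measurable_itv.
apply: (@bounded_finite_integrable _ RR R m _ alpha M mab measurable_weight) => y /=.
by rewrite in_itv/= => /andP[ay yb]; apply: hM; rewrite !ltW.
Qed.

(** Integrability is essential here: [Rintegral] sends an infinite integral to [0], so energies can
    be compared in [R] only for square integrable residuals. *)
Lemma TV_energyE (u : R -> R) D :
  mu.-integrable `]a, b[ (EFin \o (fun y => (f y - u y) ^+ 2)) ->
  TV_energy a b f alpha u D = (2^-1 * \int[mu]_(y in `]a, b[) ((f y - u y) ^+ 2) +
     \int[tvar D]_(y in `]a, b[) alpha y)%:E.
Proof.
move=> iW; rewrite /TV_energy EFinD EFinM !fineK//.
- have mab : measurable (`]a, b[%classic : set RR) by exact: measurable_itv.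
  exact: (integrable_fin_num mab (integrable_weight (charge_variation (hahn_posneg D)))).
- exact: integrable_fin_num.
Qed.

(** Compare with the competitor [f], whose fidelity term is [0] and whose weighted variation is
    finite. *)
Lemma integrable_residual (u : R -> R) Df D : mu.-integrable `]a, b[ (EFin \o u) ->
  (TV_energy a b f alpha u D <= TV_energy a b f alpha f Df)%E ->
  mu.-integrable `]a, b[ (EFin \o (fun y => (f y - u y) ^+ 2)).
Proof.
move=> iu.
have mW : measurable_fun `]a, b[ (fun y => (f y - u y) ^+ 2).
  apply: measurable_funX; apply: measurable_funB; apply/measurable_EFinP.
    exact: measurable_int int_f.
  exact: measurable_int iu.
rewrite [leRHS]TV_energyE; last first.
  rewrite (_ : EFin \o _ = cst 0%E); first exact: integrable0.
  by apply/funext => y /=; rewrite subrr expr0n.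
move=> le; apply/integrableP; split; first exact/measurable_EFinP.
rewrite (_ : (\int[mu]_(x in `]a, b[) `|_|)%E = \int[mu]_(x in `]a, b[) ((f x - u x) ^+ 2)%:E)%E; last first.
  by apply: eq_integral => y _ /=; rewrite ger0_norm ?sqr_ge0.
(* An infinite fidelity term would make the energy of [u] equal to [+oo]; the sum is indeed [+oo]
   because the weighted variation is nonnegative, hence not [-oo]. *)
rewrite ltey; apply/eqP => Wy; move: le; rewrite /TV_energy Wy gt0_muley// addye.
  by rewrite leNgt ltry.
suff : (0 <= \int[tvar D]_(x in `]a, b[) (alpha x)%:E)%E by case: (integral _ _ _).
apply: integral_ge0 => y; rewrite /= in_itv/= => /andP[ay yb].
by rewrite lee_fin ltW// alpha_gt0// !ltW.
Qed.

(** The energy of [u] raised by [t] on []p, q[], minus the energy of [u]: the square is expanded and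
    the variation changes only at [p] and [q]. *)
Lemma TV_minimizer_variation (u : R -> R) Df D p q t :
  TV_minimizer a b f alpha u -> distributional_derivative a b u D ->
  distributional_derivative a b f Df ->
  a < p -> p < q -> q < b ->
  0 <= - t * (\int[mu]_(y in `]p, q[) (f y - u y)) + t ^+ 2 / 2 * (q - p) +
    alpha p * (`|fine (D [set p]) + t| - `|fine (D [set p])|) +
    alpha q * (`|fine (D [set q]) - t| - `|fine (D [set q])|).
Proof.
move=> [[iu _] min] uD fDf ap pq qb.
have BVf : BV a b f by split; last exists Df.
have iW := integrable_residual iu (min _ uD f Df BVf fDf).
set v := fun y => u y + t * \1_(`]p, q[%classic) y.
have vD : distributional_derivative a b v (jump_charge D t p q).
  exact: distributional_derivative_jump.
have mab : measurable (`]a, b[%classic : set RR) by exact: measurable_itv.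
have i1 : mu.-integrable `]a, b[ (EFin \o \1_(`]p, q[%classic)).
  by apply: integrableS (integrable_indic_itv p q false true).
have iv : mu.-integrable `]a, b[ (EFin \o v).
  exact: (integrableD mab iu (integrableZl mab t i1)).
have BVv : BV a b v by split; last exists (jump_charge D t p q).
have le := min _ uD v _ BVv vD.
pose r y := f y - u y.
have ir : mu.-integrable `]a, b[ (EFin \o r) by exact: (integrableB mab int_f iu).
have sub : `]p, q[%classic `<=` `]a, b[%classic.
  by move=> z /=; rewrite !in_itv/=; lra.
have irp : mu.-integrable `]a, b[ (EFin \o (r \_ `]p, q[)).
  rewrite -restrict_EFin; apply/integrable_restrict => //.
  by apply: integrableS ir => //; exact: measurableI.
have i2 : mu.-integrable `]a, b[ (EFin \o (fun y => - (2 * t) * (r \_ `]p, q[) y)).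
  exact: (integrableZl mab _ irp).
have i3 : mu.-integrable `]a, b[ (EFin \o (fun y => t ^+ 2 * \1_(`]p, q[%classic) y)).
  exact: (integrableZl mab _ i1).
have i4 : mu.-integrable `]a, b[ (EFin \o
    (fun y => - (2 * t) * (r \_ `]p, q[) y + t ^+ 2 * \1_(`]p, q[%classic) y)).
  exact: (integrableD mab i2 i3).
have WE : (fun y => (f y - v y) ^+ 2) = (fun y => (f y - u y) ^+ 2 +
    (- (2 * t) * (r \_ `]p, q[) y + t ^+ 2 * \1_(`]p, q[%classic) y)).
  apply/funext => y; rewrite /v patchE indicE /r; case: (y \in _) => /=; first by ring.
  (* Outside []p, q[] the restriction takes the default value [point], which is [0] in [R]. *)
  by rewrite (_ : point = 0 :> R)//; ring.
have iWv : mu.-integrable `]a, b[ (EFin \o (fun y => (f y - v y) ^+ 2)).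
  by rewrite WE; exact: (integrableD mab iW i4).
move: le; rewrite !TV_energyE// lee_fin WE.
rewrite (RintegralD mab iW i4) (RintegralD mab i2 i3).
rewrite (RintegralZl _ mab irp) (RintegralZl _ mab i1).
have -> : \int[mu]_(y in `]a, b[) (r \_ `]p, q[) y = \int[mu]_(y in `]p, q[) (f y - u y).
  by rewrite -Rintegral_mkcondr; congr Rintegral; apply/setIidPr.
have -> : \int[mu]_(y in `]a, b[) \1_(`]p, q[%classic) y = q - p.
  rewrite /Rintegral integral_indic//.
  rewrite (_ : _ `&` _ = `]p, q[%classic); last exact/setIidPl.
  by rewrite /= lebesgue_measure_itv/= lte_fin pq.
have pab : `]a, b[%classic p by rewrite /= in_itv/=; lra.
have qab : `]a, b[%classic q by rewrite /= in_itv/=; lra.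
have npq : p != q by rewrite lt_eqF.
have [M hM] := within_continuous_bounded alpha_cont.
have hM' y : `]a, b[%classic y -> `|alpha y| <= M.
  by rewrite /= in_itv/= => /andP[ay yb]; apply: hM; rewrite !ltW.
rewrite (tvar_integral_jump D t mab pab qab npq measurable_weight hM').
lra.
Qed.

End energy_variation.

(** Divide by [s] and let [s] tend to [0]; this removes the second-order term of the energy
    variation. *)
Lemma ge0_of_quadratic (R : realType) (A B c : R) : 0 < c ->
  (forall s, 0 < s -> s <= c -> 0 <= s * A + s ^+ 2 * B) -> 0 <= A.
Proof.
move=> c0 H; rewrite leNgt; apply/negP => A0.
(* For [A < 0] this choice gives [s * |B| <= - A / 2], so [A + s * B] is still negative. *)
pose s := Num.min c (- A / (2 * (`|B| + 1))).
have B1 : 0 < 2 * (`|B| + 1) by rewrite mulr_gt0// ltr_wpDl.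
have s0 : 0 < s by rewrite lt_min c0 divr_gt0// oppr_gt0.
have sc : s <= c by rewrite ge_min lexx.
have sB : s * (2 * (`|B| + 1)) <= - A by rewrite -ler_pdivlMr// ge_min lexx orbT.
have := H s s0 sc; rewrite expr2 -mulrA -mulrDr pmulr_rge0//.
have : s * B <= s * `|B| by rewrite ler_pM2l// ler_norm.
lra.
Qed.

(** * Comparison of the jumps of the minimiser and of the data *)

Section jump_inequality.
Context (R : realType).
Local Notation RR := (measurableTypeR R).
Local Notation mu := (@lebesgue_measure R).
Implicit Types (D : {charge set RR -> \bar R}).

Lemma Rintegral_itv_cc_oo (p q : R) (g : R -> R) : mu.-integrable `[p, q] (EFin \o g) ->
  \int[mu]_(y in `[p, q]) g y = \int[mu]_(y in `]p, q[) g y.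
Proof.
move=> ig; rewrite [RHS]Rintegral_itv_bndo_bndc; last first.
  by apply: integrableS ig => //; exact: subset_itvW.
rewrite Rintegral_itv_obnd_cbnd//.
by apply: integrableS ig => //; exact: subset_itv_oc_cc.
Qed.

Variables (a b : R) (f alpha alpha' u : R -> R)
  (Df Dalpha' Du : {charge set RR -> \bar R}).
Hypotheses (int_f : mu.-integrable `]a, b[ (EFin \o f))
  (fDf : distributional_derivative a b f Df)
  (alpha_cont : {within `[a, b], continuous alpha})
  (walpha' : weak_derivative a b alpha alpha')
  (int_alpha' : mu.-integrable `]a, b[ (EFin \o alpha'))
  (alpha'D : distributional_derivative a b alpha' Dalpha')
  (alpha_gt0 : forall y, a <= y <= b -> 0 < alpha y)
  (umin : TV_minimizer a b f alpha u)
  (uDu : distributional_derivative a b u Du).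

(** [TV_minimizer_variation] is used with [t = - (k * s)] on []x, x + h[] and [t = k * s] on []x -
    h, x[]. The absolute mass at [x] drops by exactly [s]; at the other endpoint, where the mass is
    arbitrary, it grows by at most [s]. Taking [k] with square [1] treats both jump directions at
    once. *)
Lemma jump_shift_inequality (x h k : R) : a < x - h -> 0 < h -> x + h < b ->
  k ^+ 2 = 1 -> 0 < k * fine (Du [set x]) ->
  0 <= k * (\int[mu]_(y in `]x, x + h[) (f y - u y) - \int[mu]_(y in `]x - h, x[) (f y - u y)) +
    (alpha (x + h) - alpha x) + (alpha (x - h) - alpha x).
Proof.
move=> axh h0 xhb k2 kc; set c := fine (Du [set x]) in kc *.
have k1 : `|k| = 1 by apply/eqP; rewrite -sqrp_eq1// real_normK ?k2// num_real.
have shrink s : 0 < s -> s <= k * c -> `|c - k * s| - `|c| = - s.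
  move=> s0 sc.
  have -> : `|c| = k * c by rewrite -[RHS]gtr0_norm// normrM k1 mul1r.
  have -> : c - k * s = k * (k * c - s) by rewrite mulrBr mulrA -expr2 k2 mul1r.
  by rewrite normrM k1 mul1r ger0_norm ?subr_ge0//; ring.
have grow d s : 0 < s -> `|d + k * s| - `|d| <= s /\ `|d - k * s| - `|d| <= s.
  move=> s0; have ks : `|k * s| = s by rewrite normrM k1 mul1r gtr0_norm.
  split; rewrite lerBlDl; first by rewrite (le_trans (ler_normD _ _))// ks.
  by rewrite (le_trans (ler_normB _ _))// ks.
have ax : a < x by lra.
have xb : x < b by lra.
have right : 0 <= k * \int[mu]_(y in `]x, x + h[) (f y - u y) + (alpha (x + h) - alpha x).
  (* [B] comes from [t ^+ 2 / 2] times the length [h], with [t ^+ 2 = s ^+ 2]; [s] may not exceed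
     [k * c], the size of the jump. *)
  apply: (ge0_of_quadratic (B := h / 2) kc) => s s0 sc.
  have xx : x < x + h by rewrite ltrDl.
  have := TV_minimizer_variation int_f alpha_cont alpha_gt0 (- (k * s)) umin uDu fDf
    ax xx xhb.
  rewrite -/c shrink// opprK sqrrN exprMn k2 mul1r.
  have [+ _] := grow (fine (Du [set (x + h)])) s s0.
  have aq : 0 < alpha (x + h) by apply: alpha_gt0; lra.
  rewrite -(ler_pM2l aq).
  move: (alpha (x + h) * (_ - _)) (\int[mu]_(_ in _) _) => A I H1 H2.
  apply: (le_trans H2); lra.
have left : 0 <= - k * \int[mu]_(y in `]x - h, x[) (f y - u y) + (alpha (x - h) - alpha x).
  apply: (ge0_of_quadratic (B := h / 2) kc) => s s0 sc.
  have xx : x - h < x by rewrite gtrBl.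
  have := TV_minimizer_variation int_f alpha_cont alpha_gt0 (k * s) umin uDu fDf
    axh xx xb.
  rewrite -/c shrink// exprMn k2 mul1r.
  have [+ _] := grow (fine (Du [set (x - h)])) s s0.
  have aq : 0 < alpha (x - h) by apply: alpha_gt0; lra.
  rewrite -(ler_pM2l aq).
  move: (alpha (x - h) * (_ - _)) (\int[mu]_(_ in _) _) => A I H1 H2.
  apply: (le_trans H2); lra.
lra.
Qed.

Lemma jump_inequality (x k : R) : a < x < b -> fine (Dalpha' [set x]) = 0 ->
  k ^+ 2 = 1 -> 0 < k * fine (Du [set x]) ->
  k * fine (Du [set x]) <= k * fine (Df [set x]).
Proof.
move=> /andP[ax xb] Da0 k2 kc.
have k1 : `|k| = 1 by apply/eqP; rewrite -sqrp_eq1// real_normK ?k2// num_real.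
have iu : mu.-integrable `]a, b[ (EFin \o u) by have [[]] := umin.
(* Half the distance from [x] to the boundary keeps all endpoints strictly inside []a, b[]. *)
pose r := Num.min (x - a) (b - x) / 2.
have m0 : 0 < Num.min (x - a) (b - x) by rewrite lt_min !subr_gt0 ax.
have r0 : 0 < r by rewrite divr_gt0.
have ra : a < x - r.
  have : Num.min (x - a) (b - x) <= x - a by rewrite ge_min lexx.
  rewrite /r; lra.
have rb : x + r < b.
  have : Num.min (x - a) (b - x) <= b - x by rewrite ge_min lexx orbT.
  rewrite /r; lra.
pose K (D : {charge set RR -> \bar R}) (h : R) := fine (tvar D (`[x - h, x + h] `\ x)).
suff : 0 <= k * (fine (Df [set x]) - fine (Du [set x])) by rewrite mulrBr subr_ge0.
pose h n := r * n.+1%:R^-1.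
(* The three terms [K] tend to [0], so it suffices to prove, for each [h n], the inequality with
   these errors added. *)
have cK : K Df (h n) + K Du (h n) + K Dalpha' (h n) +
   k * (fine (Df [set x]) - fine (Du [set x])) @[n --> \oo] -->
   k * (fine (Df [set x]) - fine (Du [set x])).
  rewrite -[X in _ --> X]add0r; apply: cvgD; last exact: cvg_cst.
  rewrite -[X in _ --> X]addr0; apply: cvgD; last exact: tvar_punctured_cvg.
  by rewrite -[X in _ --> X]addr0; apply: cvgD; exact: tvar_punctured_cvg.
apply: (cvgr_to_ge cK); apply: nearW => n.
have h0 : 0 < h n by exact: divS_gt0.
have hr : h n <= r by exact: divS_le.
move: (h n) h0 hr => {cK h n} h h0 hr.
have ah : a < x - h by lra.
have hb : x + h < b by lra.
have Ef := jump_estimate int_f fDf h0 ah hb.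
have Eu := jump_estimate iu uDu h0 ah hb.
have Ea := jump_estimate int_alpha' alpha'D h0 ah hb.
have S := jump_shift_inequality ah h0 hb k2 kc.
have sub (p q : R) (g : R -> R) : a < p -> q < b -> mu.-integrable `]a, b[ (EFin \o g) ->
    mu.-integrable `[p, q] (EFin \o g).
  move=> ap qb ig; apply: integrableS ig => // z /=.
  by rewrite !in_itv/=; lra.
have subo (p q : R) (g : R -> R) : a < p -> q < b -> mu.-integrable `]a, b[ (EFin \o g) ->
    mu.-integrable `]p, q[ (EFin \o g).
  by move=> ap qb /(sub _ _ _ ap qb) ig; apply: integrableS ig => //; exact: subset_itvW.
(* As integrals of [alpha'], the two increments add up to the difference of half-interval integrals
   estimated in [Ea]. *)
have R1 : alpha (x + h) - alpha x = \int[mu]_(y in `]x, x + h[) alpha' y.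
  rewrite (weak_derivative_ftc _ _ _ alpha_cont int_alpha' walpha')//; last by lra.
  by rewrite Rintegral_itv_cc_oo//; exact: sub.
have R2 : alpha x - alpha (x - h) = \int[mu]_(y in `]x - h, x[) alpha' y.
  rewrite (weak_derivative_ftc _ _ _ alpha_cont int_alpha' walpha')//; last by lra.
  by rewrite Rintegral_itv_cc_oo//; exact: sub.
have SB (p q : R) : a < p -> q < b -> \int[mu]_(y in `]p, q[) (f y - u y) =
    \int[mu]_(y in `]p, q[) f y - \int[mu]_(y in `]p, q[) u y.
  by move=> ap qb; apply: RintegralB => //; exact: subo.
move: S; rewrite !SB// R1 -[alpha (x - h) - alpha x]opprB R2.
rewrite Da0 mulr0 addr0 in Ea.
rewrite /K; move: Ef Eu Ea.
set Fl := Rintegral _ _ _; set Fr := Rintegral _ _ _.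
set kf := fine (tvar _ _).
set Ul := Rintegral _ _ _; set Ur := Rintegral _ _ _.
set ku := fine (tvar _ _).
set Al := Rintegral _ _ _; set Ar := Rintegral _ _ _.
set ka := fine (tvar _ _).
set df := fine _; set du := fine _.
move=> Ef Eu /ler_normlP[Ea1 Ea2] S.
(* As [|k| = 1], the estimates survive multiplication by [k] and then match the terms of [S]. *)
have : `|k * (Fl - Fr + h * df)| <= h * kf by rewrite normrM k1 mul1r.
have : `|k * (Ul - Ur + h * du)| <= h * ku by rewrite normrM k1 mul1r.
move=> /ler_normlP[Eu1 Eu2] /ler_normlP[Ef1 Ef2].
rewrite -(pmulr_rge0 _ h0); lra.
Qed.

End jump_inequality.

Theorem proposition3p9 (R : realType) (a b : R) (hab : a < b)
    (f alpha alpha' u : R -> R)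
    (Df Dalpha' Du : {charge set (measurableTypeR R) -> \bar R})
    (hf : BV a b f)
    (hDf : distributional_derivative a b f Df)
    (alpha_cont : {within `[a, b], continuous alpha})
    (halpha' : weak_derivative a b alpha alpha')
    (alpha'_BV : BV a b alpha')
    (hDalpha' : distributional_derivative a b alpha' Dalpha')
    (alpha_gt0 : forall y, a <= y <= b -> 0 < alpha y)
    (hu : TV_minimizer a b f alpha u)
    (hDu : distributional_derivative a b u Du)
    (x : R) (hx : a < x < b)
    (hjump : tvar Dalpha' [set x] = 0%E) :
  (tvar Du [set x] <= tvar Df [set x])%E /\
  (Du [set x] != 0%E -> Df [set x] != 0%E ->
   ((0 < Du [set x])%E /\ (0 < Df [set x])%E) \/
   ((Du [set x] < 0)%E /\ (Df [set x] < 0)%E)).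
Proof.
have fin D : (D : {charge set (measurableTypeR R) -> \bar R}) [set x] = (fine (D [set x]))%:E.
  by rewrite fineK//; exact: fin_num_measure.
have Da0 : fine (Dalpha' [set x]) = 0.
  by move: hjump; rewrite tvar_set1// => /eqP; rewrite abse_eq0 => /eqP ->.
have J k := @jump_inequality R a b f alpha alpha' u Df Dalpha' Du hf.1 hDf alpha_cont
  halpha' alpha'_BV.1 hDalpha' alpha_gt0 hu hDu x k hx Da0.
rewrite !tvar_set1// (fin Du) (fin Df) !abse_EFin !lee_fin !lte_fin !eqe.
move: (fine (Du _)) (fine (Df _)) J => c d J.
(* With [k] the sign of [c], the inequality [k * c <= k * d] bounds [|c|] by [|d|] and also forces
   [d] to have the sign of [c]. For [c = 0] both claims are trivial. *)
have [c0|c0|->] := ltgtP c 0.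
- have := J (-1); rewrite sqrrN expr1n !mulN1r oppr_gt0 lerN2 => /(_ erefl c0) dc.
  have d0 := le_lt_trans dc c0.
  by split; [rewrite !ltr0_norm// lerN2|right].
- have := J 1; rewrite expr1n !mul1r => /(_ erefl c0) cd.
  have d0 := lt_le_trans c0 cd.
  by split; [rewrite !gtr0_norm|left].
- by rewrite normr0.
Qed.
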